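(* Let $V$ be an $n$-dimensional real inner-product vector space and let $Cl(V)$ denote its associated Clifford algebra. Let $\vec n,\vec c\in V$, where $\vec n$ is a unit vector, i.e. $\vec n\diamond\vec n=1$. For every integer $p\ge 2$, consider $$f(\vec x)=(\vec x\diamond\vec n)^p\diamond\vec n+\vec c,\qquad \vec x\in V.$$ Then $f(\vec x)\in\langle Cl(V)\rangle_1=V$ for every $\vec x\in V$; that is, $f$ is well-defined as a map $f:V\to V$.
   Context: $Cl(V)$ is the real Clifford (geometric) algebra of the inner-product space $V$: the associative unital real algebra generated by $V$ subject to $\vec v\diamond\vec v=\vec v\cdot\vec v$ for $\vec v\in V$, where $\cdot$ is the inner product. $\diamond$ denotes the product of $Cl(V)$ (the geometric product); for vectors $\vec a,\vec b\in V$ it decomposes as $\vec a\diamond\vec b=\vec a\cdot\vec b+\vec a\wedge\vec b$, with $\wedge$ the outer (exterior) product. $V$ is identified with its image in $Cl(V)$, which is the grade-$1$ subspace $\langle Cl(V)\rangle_1$. Powers are taken with respect to $\diamond$. The integer $n=\dim V$ and the vector $\vec n$ are unrelated. *)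

(* Defs.v *)
From HB Require Import structures.
From mathcomp Require Import all_boot all_order all_algebra generic_quotient.
From mathcomp Require Import boolp classical_sets reals.

Set Implicit Arguments.
Unset Strict Implicit.
Unset Printing Implicit Defensive.

Import Order.TTheory GRing.Theory Num.Theory.

Local Open Scope ring_scope.
Local Open Scope quotient_scope.

(* The inner product is a positive definite symmetric bilinear form, the
   library's {dot V for idfun}.  The Clifford algebra is the real unital
   associative algebra presented by the generators v : V, linear in v, and the
   relations v * v = dot v v: formal expressions modulo the least congruence
   [cl_eq] imposing the algebra axioms and these relations. *)

Section Presentation.
Context (R : realType) (V : vectType R) (dot : {dot V for idfun}).

Inductive cl_term : Type :=
| ClVec of V
| ClScal of R
| ClAdd of cl_term & cl_term
| ClMul of cl_term & cl_term.

Inductive cl_eq : cl_term -> cl_term -> Prop :=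
| cl_refl x : cl_eq x x
| cl_sym x y : cl_eq x y -> cl_eq y x
| cl_trans x y z : cl_eq x y -> cl_eq y z -> cl_eq x z
| cl_congD x x' y y' :
    cl_eq x x' -> cl_eq y y' -> cl_eq (ClAdd x y) (ClAdd x' y')
| cl_congM x x' y y' :
    cl_eq x x' -> cl_eq y y' -> cl_eq (ClMul x y) (ClMul x' y')
| cl_addA x y z : cl_eq (ClAdd x (ClAdd y z)) (ClAdd (ClAdd x y) z)
| cl_addC x y : cl_eq (ClAdd x y) (ClAdd y x)
| cl_add0 x : cl_eq (ClAdd (ClScal 0) x) x
| cl_mulA x y z : cl_eq (ClMul x (ClMul y z)) (ClMul (ClMul x y) z)
| cl_mul1 x : cl_eq (ClMul (ClScal 1) x) x
| cl_mul0 x : cl_eq (ClMul (ClScal 0) x) (ClScal 0)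
| cl_mulDl x y z :
    cl_eq (ClMul (ClAdd x y) z) (ClAdd (ClMul x z) (ClMul y z))
| cl_mulDr x y z :
    cl_eq (ClMul x (ClAdd y z)) (ClAdd (ClMul x y) (ClMul x z))
| cl_scalD a b : cl_eq (ClScal (a + b)) (ClAdd (ClScal a) (ClScal b))
| cl_scalM a b : cl_eq (ClScal (a * b)) (ClMul (ClScal a) (ClScal b))
| cl_scalC a x : cl_eq (ClMul (ClScal a) x) (ClMul x (ClScal a))
| cl_vecD u v : cl_eq (ClVec (u + v)) (ClAdd (ClVec u) (ClVec v))
| cl_vecZ a v : cl_eq (ClVec (a *: v)) (ClMul (ClScal a) (ClVec v))
| cl_vec2 v : cl_eq (ClMul (ClVec v) (ClVec v)) (ClScal (dot v v)).

HB.instance Definition _ := gen_eqMixin cl_term.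
HB.instance Definition _ := gen_choiceMixin cl_term.

Definition cl_rel (x y : cl_term) : bool := `[< cl_eq x y >].

Lemma cl_rel_equiv : equiv_class_of cl_rel.
Proof.
split.
- by move=> x; apply/asboolP; exact: cl_refl.
- by move=> x y; apply/asboolP/asboolP; exact: cl_sym.
- move=> y x z /asboolP xy /asboolP yz; apply/asboolP.
  exact: cl_trans xy yz.
Qed.

Canonical cl_equiv := EquivRelPack cl_rel_equiv.

Definition clifford : Type := {eq_quot cl_equiv}.

HB.instance Definition _ := Choice.on clifford.
HB.instance Definition _ : EqQuotient _ cl_equiv clifford :=
  EqQuotient.on clifford.

Definition cl_cls (x : cl_term) : clifford := \pi_clifford x.

Lemma cl_clsP x y : cl_cls x = cl_cls y <-> cl_eq x y.
Proof.
split; first by move=> /eqmodP /asboolP.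
by move=> xy; apply/eqmodP/asboolP.
Qed.

Lemma cl_reprK x : cl_cls (repr x) = x.
Proof. exact: reprK. Qed.

Lemma cl_eq_repr x : cl_eq (repr (cl_cls x)) x.
Proof. by apply/cl_clsP; rewrite cl_reprK. Qed.

Definition cl_scal (a : R) : clifford := cl_cls (ClScal a).
Definition cl_add (x y : clifford) : clifford :=
  cl_cls (ClAdd (repr x) (repr y)).
Definition cl_mul (x y : clifford) : clifford :=
  cl_cls (ClMul (repr x) (repr y)).
Definition cl_opp (x : clifford) : clifford := cl_mul (cl_scal (-1)) x.
Definition cl_scale (a : R) (x : clifford) : clifford := cl_mul (cl_scal a) x.

Lemma cl_addE x y : cl_add (cl_cls x) (cl_cls y) = cl_cls (ClAdd x y).
Proof. by apply/cl_clsP; apply: cl_congD; exact: cl_eq_repr. Qed.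

Lemma cl_mulE x y : cl_mul (cl_cls x) (cl_cls y) = cl_cls (ClMul x y).
Proof. by apply/cl_clsP; apply: cl_congM; exact: cl_eq_repr. Qed.

Lemma cl_clsW (P : clifford -> Prop) :
  (forall x, P (cl_cls x)) -> forall x, P x.
Proof. by move=> Pcls x; rewrite -(cl_reprK x). Qed.

Lemma cl_addrA : associative cl_add.
Proof.
elim/cl_clsW => x; elim/cl_clsW => y; elim/cl_clsW => z.
by rewrite !cl_addE; apply/cl_clsP; exact: cl_addA.
Qed.

Lemma cl_addrC : commutative cl_add.
Proof.
elim/cl_clsW => x; elim/cl_clsW => y.
by rewrite !cl_addE; apply/cl_clsP; exact: cl_addC.
Qed.

Lemma cl_add0r : left_id (cl_scal 0) cl_add.
Proof. by elim/cl_clsW => x; rewrite cl_addE; apply/cl_clsP/cl_add0. Qed.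

Lemma cl_mulrA : associative cl_mul.
Proof.
elim/cl_clsW => x; elim/cl_clsW => y; elim/cl_clsW => z.
by rewrite !cl_mulE; apply/cl_clsP; exact: cl_mulA.
Qed.

Lemma cl_mul1r : left_id (cl_scal 1) cl_mul.
Proof. by elim/cl_clsW => x; rewrite cl_mulE; apply/cl_clsP/cl_mul1. Qed.

Lemma cl_scalrC a x : cl_mul (cl_scal a) x = cl_mul x (cl_scal a).
Proof. by elim/cl_clsW: x => x; rewrite !cl_mulE; apply/cl_clsP/cl_scalC. Qed.

Lemma cl_mulr1 : right_id (cl_scal 1) cl_mul.
Proof. by move=> x; rewrite -cl_scalrC cl_mul1r. Qed.

Lemma cl_mulrDl : left_distributive cl_mul cl_add.
Proof.
elim/cl_clsW => x; elim/cl_clsW => y; elim/cl_clsW => z.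
by rewrite !(cl_addE, cl_mulE); apply/cl_clsP/cl_mulDl.
Qed.

Lemma cl_mulrDr : right_distributive cl_mul cl_add.
Proof.
elim/cl_clsW => x; elim/cl_clsW => y; elim/cl_clsW => z.
by rewrite !(cl_addE, cl_mulE); apply/cl_clsP/cl_mulDr.
Qed.

Lemma cl_scalrD a b : cl_scal (a + b) = cl_add (cl_scal a) (cl_scal b).
Proof. by rewrite cl_addE; apply/cl_clsP/cl_scalD. Qed.

Lemma cl_scalrM a b : cl_scal (a * b) = cl_mul (cl_scal a) (cl_scal b).
Proof. by rewrite cl_mulE; apply/cl_clsP/cl_scalM. Qed.

Lemma cl_addNr : left_inverse (cl_scal 0) cl_opp cl_add.
Proof.
move=> x; rewrite /cl_opp -{2}(cl_mul1r x) -cl_mulrDl -cl_scalrD addNr.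
by elim/cl_clsW: x => x; rewrite cl_mulE; apply/cl_clsP/cl_mul0.
Qed.

Section Evaluation.
Context (A : algType R) (g : {linear V -> A}).

Fixpoint cl_eval (t : cl_term) : A :=
  match t with
  | ClVec v => g v
  | ClScal a => a%:A
  | ClAdd x y => cl_eval x + cl_eval y
  | ClMul x y => cl_eval x * cl_eval y
  end.

Hypothesis g2 : forall v, g v * g v = (dot v v)%:A.

Lemma cl_evalP x y : cl_eq x y -> cl_eval x = cl_eval y.
Proof.
elim=> {x y} //=.
- by move=> x y z _ -> _ ->.
- by move=> x x' y y' _ -> _ ->.
- by move=> x x' y y' _ -> _ ->.
- by move=> x y z; rewrite addrA.
- by move=> x y; rewrite addrC.
- by move=> x; rewrite scale0r add0r.
- by move=> x y z; rewrite mulrA.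
- by move=> x; rewrite scale1r mul1r.
- by move=> x; rewrite scale0r mul0r.
- by move=> x y z; rewrite mulrDl.
- by move=> x y z; rewrite mulrDr.
- by move=> a b; rewrite scalerDl.
- by move=> a b; rewrite mulr_algl scalerA.
- by move=> a x; rewrite mulr_algl mulr_algr.
- by move=> u v; rewrite linearD.
- by move=> a v; rewrite linearZ /= mulr_algl.
Qed.

End Evaluation.

(* A matrix representation of the relations, by induction on a subspace; it
   shows that the quotient is not the zero ring. *)
Lemma cl_matrix_repr (U : {vspace V}) :
  exists m (g : V -> 'M[R]_m.+1),
    linear g /\ forall v, v \in U -> g v *m g v = (dot v v)%:M.
Proof.
have [k] := ubnP (\dim U); elim: k U => // k IHk U; rewrite ltnS => dimU.
have [->|U0] := eqVneq U 0%VS.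
  exists 0%N, (fun=> 0); split=> [a u v|v]; first by rewrite scaler0 addr0.
  rewrite memv0 => /eqP ->.
  by rewrite mulmx0 linear0l raddf0.
pose e := vpick U.
have Ue : e \in U by exact: memv_pick.
have e0 : e != 0 by rewrite vpick0.
have ee : dot e e != 0 by rewrite gt_eqF// neq0_dnorm_gt0.
pose d (v : V) : R^o := dot v e.
have dL : linear d by move=> a u v; rewrite /d linearPl.
pose dl : {linear V -> R^o} := HB.pack d (GRing.isLinear.Build R V R^o *:%R d dL).
pose W := (U :&: lker (linfun dl))%VS.
have We : e \notin W.
  by rewrite memv_cap Ue memv_ker lfunE.
have dimW : (\dim W < k)%N.
  apply: leq_trans dimU; rewrite ltn_neqAle dimvS ?capvSl// andbT.
  apply: contra We => /eqP dWU; suff -> : W = U by [].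
  by apply/eqP; rewrite eqEdim capvSl dWU leqnn.
have [m [g [gL gW]]] := IHk W dimW.
pose w v := v - (d v / dot e e) *: e.
have wL : linear w.
  move=> a u v; rewrite /w dL scalerBr addrACA -opprD; congr (_ - _).
  by rewrite mulrDl scalerDl -mulrA scalerA.
pose h v : 'M[R]_(m.+1 + m.+1) :=
  block_mx (g (w v)) (d v)%:M (d v / dot e e)%:M (- g (w v)).
have hL a u v : h (a *: u + v) = a *: h u + h v.
  rewrite /h wL gL dL scale_block_mx add_block_mx; congr block_mx.
  - by rewrite raddfD/= -scale_scalar_mx.
  - by rewrite mulrDl raddfD/= -mulrA scale_scalar_mx.
  - by rewrite opprD scalerN.
suff h2 v : v \in U -> h v *m h v = (dot v v)%:M.
  by exists (m + m.+1)%N, h; split.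
move=> Uv.
have dwe : dot (w v) e = 0.
  by rewrite /w linearBl linearZl_LR /= divfK// subrr.
have Ww : w v \in W.
  rewrite memv_cap memv_ker lfunE/= /d dwe eqxx andbT.
  by rewrite memvB// memvZ.
have dew : dot e (w v) = 0 by rewrite hermC/= dwe mulr0.
have dvv : dot v v = dot (w v) (w v) + d v * (d v / dot e e).
  have {1 2}-> : v = (d v / dot e e) *: e + w v by rewrite addrC subrK.
  move: (w v) dwe dew => u due deu.
  rewrite linearDl !linearD/= !linearZl_LR !linearZr_LR/= due deu !mulr0 addr0.
  by rewrite add0r addrC divfK// mulrC.
rewrite /h mulmx_block !mul_scalar_mx !mul_mx_scalar gW// mulNmx mulmxN opprK.
rewrite gW// !scale_scalar_mx -!scalerDr subrr !scaler0.
by rewrite -!raddfD/= (mulrC _ (d v)) [X in block_mx _ _ _ X%:M]addrC -dvv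
  -scalar_mx_block.
Qed.

Lemma cl_scal_neq0 : cl_scal 1 != cl_scal 0.
Proof.
have [m [g [gL g2]]] := cl_matrix_repr fullv.
pose gl : {linear V -> 'M[R]_m.+1} :=
  HB.pack g (GRing.isLinear.Build R V 'M[R]_m.+1 *:%R g gL).
apply/eqP => /cl_clsP /(@cl_evalP _ gl) /= /(_ _)/eqP.
rewrite scale1r scale0r oner_eq0 => /(_ _)/notF; apply => v.
by rewrite -[_ * _]/(g v *m g v) g2 ?memvf// -scalemx1.
Qed.

HB.instance Definition _ := GRing.isNzRing.Build clifford
  cl_addrA cl_addrC cl_add0r cl_addNr cl_mulrA cl_mul1r cl_mulr1
  cl_mulrDl cl_mulrDr cl_scal_neq0.

Lemma cl_scalerA a b x : cl_scale a (cl_scale b x) = cl_scale (a * b) x.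
Proof. by rewrite /cl_scale cl_mulrA -cl_scalrM. Qed.

Lemma cl_scale1r : left_id 1 cl_scale.
Proof. exact: cl_mul1r. Qed.

Lemma cl_scalerDr : right_distributive cl_scale +%R.
Proof. by move=> a x y; exact: cl_mulrDr. Qed.

Lemma cl_scalerDl x : {morph cl_scale^~ x : a b / a + b}.
Proof. by move=> a b; rewrite /cl_scale cl_scalrD; exact: cl_mulrDl. Qed.

HB.instance Definition _ := GRing.Zmodule_isLmodule.Build R clifford
  cl_scalerA cl_scale1r cl_scalerDr cl_scalerDl.

Lemma cl_scalerAl a (x y : clifford) : a *: (x * y) = (a *: x) * y.
Proof. exact: cl_mulrA. Qed.

HB.instance Definition _ :=
  GRing.Lmodule_isLalgebra.Build R clifford cl_scalerAl.

Lemma cl_scalerAr a (x y : clifford) : a *: (x * y) = x * (a *: y).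
Proof.
by rewrite -[LHS]/(cl_mul _ (cl_mul _ _)) cl_mulrA cl_scalrC -cl_mulrA.
Qed.

HB.instance Definition _ :=
  GRing.Lalgebra_isAlgebra.Build R clifford cl_scalerAr.

Definition cl_vec (v : V) : clifford := cl_cls (ClVec v).

Lemma cl_vec_linear : linear cl_vec.
Proof.
move=> a u v; rewrite -[RHS]/(cl_add (cl_mul _ _) _).
rewrite cl_mulE cl_addE; apply/cl_clsP.
apply: cl_trans (cl_vecD _ _) _.
by apply: cl_congD; [exact: cl_vecZ|exact: cl_refl].
Qed.

HB.instance Definition _ :=
  GRing.isLinear.Build R V clifford *:%R cl_vec cl_vec_linear.

Lemma cl_scalE a : cl_scal a = a%:A.
Proof. by rewrite -[RHS]/(cl_mul _ _) cl_mulr1. Qed.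

Lemma cl_vec_sqr v : cl_vec v * cl_vec v = (dot v v)%:A.
Proof.
by rewrite -cl_scalE -[LHS]/(cl_mul _ _) cl_mulE; apply/cl_clsP/cl_vec2.
Qed.

Theorem clifford_universal (A : algType R) (g : {linear V -> A}) :
  (forall v, g v * g v = (dot v v)%:A) ->
  exists2 h : {lrmorphism clifford -> A}, (forall v, h (cl_vec v) = g v) &
    forall h' : {lrmorphism clifford -> A},
      (forall v, h' (cl_vec v) = g v) -> h' =1 h.
Proof.
move=> g2; pose h (x : clifford) : A := cl_eval g (repr x).
have hE t : h (cl_cls t) = cl_eval g t.
  by apply: (cl_evalP g2); exact: cl_eq_repr.
have hL : linear h.
  move=> a; elim/cl_clsW => x; elim/cl_clsW => y.
  rewrite -[X in h X]/(cl_add (cl_mul _ _) _) cl_mulE cl_addE !hE /=.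
  by rewrite mulr_algl.
have hM : monoid_morphism h.
  split; first by rewrite -[X in h X]/(cl_cls _) hE /= scale1r.
  elim/cl_clsW => x; elim/cl_clsW => y.
  by rewrite -[X in h X]/(cl_mul _ _) cl_mulE !hE.
pose hl : {lrmorphism clifford -> A} := HB.pack h
  (GRing.isLinear.Build R clifford A *:%R h hL)
  (GRing.isMonoidMorphism.Build clifford A h hM).
exists hl => [v|h' h'g]; first exact: hE.
elim/cl_clsW; elim=> [v|a|x IHx y IHy|x IHx y IHy].
- by rewrite h'g; symmetry; exact: hE.
- by rewrite -[cl_cls _]/(cl_scal a) cl_scalE !linearZ !rmorph1.
- by rewrite -cl_addE -[cl_add _ _]/(cl_cls x + cl_cls y) (rmorphD h') (rmorphD hl); congr (_ + _).
- by rewrite -cl_mulE -[cl_mul _ _]/(cl_cls x * cl_cls y) (rmorphM h') (rmorphM hl); congr (_ * _).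
Qed.

(* The grade-k part is spanned by the k-blades, the products of k pairwise
   orthogonal vectors (for which the geometric and outer products agree). *)
Definition cl_blade (k : nat) : set clifford :=
  [set b | exists2 v : 'I_k -> V,
     (forall i j, i != j -> dot (v i) (v j) = 0) &
     b = \prod_(i < k) cl_vec (v i)].

Definition cl_grade (k : nat) : set clifford :=
  [set a | exists m (r : 'I_m -> R) (b : 'I_m -> clifford),
     (forall i, cl_blade k (b i)) /\ a = \sum_(i < m) r i *: b i].

Lemma cl_grade1 : cl_grade 1 = range cl_vec.
Proof.
apply/seteqP; split=> [_ [m [r [b [bP ->]]]]|_ [v _ <-]].
  elim/big_ind: _ => [|_ _ [u _ <-] [v _ <-]|i _].
  - by exists 0; rewrite ?raddf0.
  - by exists (u + v); rewrite ?raddfD.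
  - have [v _ ->] := bP i; exists (r i *: v ord0) => //.
    by rewrite linearZ big_ord1.
exists 1%N, (fun=> 1), (fun=> cl_vec v).
split; last by rewrite big_ord1 scale1r.
by move=> _; exists (fun=> v); [move=> i j; rewrite !ord1|rewrite big_ord1].
Qed.

End Presentation.

Arguments cl_blade {R V} dot k.
Arguments cl_grade {R V} dot k.

(* Main.v *)
Require Import Defs.
From HB Require Import structures.
From mathcomp Require Import all_boot all_order all_algebra.
From mathcomp Require Import boolp classical_sets reals.

(** In the Clifford algebra, the product [z] of two vectors [x] and [y] is a
    root of a real quadratic polynomial: polarizing the relation that a vector
    squares to its inner product with itself gives [x y + y x = 2 (x . y)], hence
    [z ^ 2 = 2 (x . y) z - (x . x) (y . y)].  Multiplying by [z ^ p y] turns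
    this into a two-term linear recurrence with real coefficients for the
    sequence [z ^ p y], whose first two terms, [y] and [x y y = (y . y) x], are
    vectors; so all its terms are ([cl_vec_mul_expr_mul]).  The map [F] is
    unique because a positive definite form makes the embedding of the vectors
    injective ([cl_vec_inj]). *)

Set Implicit Arguments.
Unset Strict Implicit.
Unset Printing Implicit Defensive.

Import Order.TTheory GRing.Theory Num.Theory.
Local Open Scope ring_scope.

Section VectorProducts.
Context (R : realType) (V : vectType R) (dot : {dot V for idfun}).
Local Notation vec := (cl_vec dot).

(** A vector in the kernel has square zero, that is, norm zero, and the form is
    positive definite. *)
Lemma cl_vec_inj : injective vec.
Proof.
move=> u v uv; apply/eqP; rewrite -subr_eq0.
apply: contraT => /(@neq0_dnorm_gt0 _ _ _ dot); rewrite lt0r => /andP[/negP[]].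
have : (dot (u - v) (u - v))%:A = 0 :> clifford dot.
  by rewrite -cl_vec_sqr linearB /= uv subrr mul0r.
by move/eqP; rewrite scaler_eq0 oner_eq0 orbF.
Qed.

Lemma cl_vec_anticommutator (u v : V) :
  vec u * vec v + vec v * vec u = (dot u v *+ 2)%:A.
Proof.
have dvu : dot v u = dot u v by rewrite hermC /= expr0 mul1r.
have := cl_vec_sqr dot (u + v).
rewrite linearD /= mulrDl !mulrDr !cl_vec_sqr.
rewrite linearDl !linearD /= dvu !scalerDl -!addrA => /addrI.
by rewrite !addrA => /addIr ->.
Qed.

Lemma cl_vec_mul_sqr (x y : V) :
  (vec x * vec y) ^+ 2 =
    (dot x y *+ 2) *: (vec x * vec y) - (dot x x * dot y y)%:A.
Proof.
rewrite expr2 mulrA -(mulrA (vec x)).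
have -> : vec y * vec x = (dot x y *+ 2)%:A - vec x * vec y.
  by rewrite -cl_vec_anticommutator addrC addKr.
rewrite mulrBr (mulrA (vec x) (vec x)) cl_vec_sqr mulr_algr mulrBl -scalerAl.
by rewrite -mulrA cl_vec_sqr mulr_algl scalerA.
Qed.

(** Two consecutive terms are carried along because the recurrence has order
    two: [vec x * vec y] times a single vector need not be a vector. *)
Lemma cl_vec_mul_expr_mul (x y : V) (p : nat) :
  exists w, vec w = (vec x * vec y) ^+ p * vec y.
Proof.
set z := vec x * vec y.
suff [] : (exists w, vec w = z ^+ p * vec y) /\
          (exists w, vec w = z ^+ p.+1 * vec y) by [].
elim: p => [|p [[w wE] [w' w'E]]].
  split; first by exists y; rewrite expr0 mul1r.
  by exists (dot y y *: x); rewrite linearZ /= expr1 -mulrA cl_vec_sqr mulr_algr.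
split; first by exists w'.
exists ((dot x y *+ 2) *: w' - (dot x x * dot y y) *: w).
rewrite linearB !linearZ /= wE w'E (exprD z 2 p) cl_vec_mul_sqr -/z.
by rewrite scalerN !mulrBl mulr_algl -!scalerAl -exprS.
Qed.

End VectorProducts.

Theorem theorem1 (R : realType) (n : nat) (V : vectType R)
    (dimV : \dim {:V} = n) (dot : {dot V for idfun}) (nv c : V)
    (nv_unit : cl_vec dot nv * cl_vec dot nv = 1) (p : nat) (hp : (2 <= p)%N) :
  let f (x : V) : clifford dot :=
    (cl_vec dot x * cl_vec dot nv) ^+ p * cl_vec dot nv + cl_vec dot c in
  (forall x : V, cl_grade dot 1 (f x)) /\
  (exists! F : V -> V, forall x : V, cl_vec dot (F x) = f x).
Proof.
move=> f.
have fV x : exists w, cl_vec dot w = f x.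
  have [w wE] := cl_vec_mul_expr_mul dot x nv p.
  by exists (w + c); rewrite linearD /= wE.
split=> [x|]; first by rewrite cl_grade1; have [w wE] := fV x; exists w.
have [F FE] := choice fV.
exists F; split=> // G GE; apply/funext => x.
by apply: (@cl_vec_inj _ _ dot); rewrite FE GE.
Qed.
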